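(* Let $T$ be an inverse semigroup, $I$ a set and $p:I\times I\to T$ a partial McAlister function. Then the inverse Rees matrix semigroup $IM(T,I,p)$ is isomorphic to the inverse semigroup $K(\mathcal{U}_p)$.
   Context: A semigroup $T$ is inverse if every $t\in T$ has a unique $t^*\in T$ (its generalized inverse) with $tt^*t=t$ and $t^*tt^*=t^*$. $E(T)$ is the set of idempotents of $T$, and $T$ carries the partial order $s\le t$ iff $s=te$ for some $e\in E(T)$. A map $p:I\times I\to T$, $(i,j)\mapsto p_{i,j}$, is a partial McAlister function if for all $i,j,k\in I$: (MF1) $p_{i,i}\in E(T)$; (MF2) $p_{i,i}p_{i,j}p_{j,j}=p_{i,j}$; (MF3) $p_{i,j}^*=p_{j,i}$; (MF4) $p_{i,j}p_{j,k}\le p_{i,k}$. The inverse Rees matrix semigroup: let $RM(T,I,p)=\{(j,t,i)\in I\times T\times I\mid p_{j,j}tp_{i,i}=t\}$ with multiplication $(j_2,t_2,i_2)(j_1,t_1,i_1)=(j_2,t_2p_{i_2,j_1}t_1,i_1)$. Define the equivalence relation $\gamma$ by $(j_1,t_1,i_1)\,\gamma\,(j_2,t_2,i_2)$ iff $p_{j_1,j_2}t_2p_{i_2,i_1}=t_1$ and $p_{j_2,j_1}t_1p_{i_1,i_2}=t_2$. Then $IM(T,I,p)=RM(T,I,p)/\gamma$ with the induced multiplication; it is an inverse semigroup. The set $\mathcal{U}_p$: let $\mathcal{U}_p'=\{(j,t)\in I\times T\mid p_{j,j}t=t\}$ with the equivalence relation $(j_1,t_1)\sim(j_2,t_2)$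 iff $t_1=p_{j_1,j_2}t_2$ and $t_2=p_{j_2,j_1}t_1$. Let $\mathcal{U}_p=\mathcal{U}_p'/\!\sim$, with $[j,t]$ the class of $(j,t)$, right $T$-action $[j_1,t_1]t=[j_1,t_1t]$ and right pairing $\langle[j_2,t_2]|[j_1,t_1]\rangle_{\mathcal{U}_p}=t_2^*p_{j_2,j_1}t_1\in T$ (these are well defined). $K(\mathcal{U}_p)=\{\omega_{v,u}\mid u,v\in\mathcal{U}_p\}$, where $\omega_{v,u}:\mathcal{U}_p\to\mathcal{U}_p$ is $\omega_{v,u}(u')=v\langle u|u'\rangle_{\mathcal{U}_p}$, with composition of maps as multiplication. *)

(* Defs.v *)
From HB Require Import structures.
From mathcomp Require Import ssreflect ssrfun ssrbool eqtype choice monoid.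
From mathcomp Require Import generic_quotient boolp.

Set Implicit Arguments.
Unset Strict Implicit.
Unset Printing Implicit Defensive.

Local Open Scope group_scope.
Local Open Scope quotient_scope.

(* MathComp semigroups carry a choiceType structure, and index sets below are
   choiceTypes as well; classically any type is one (boolp.gen_choiceMixin), so
   this is no restriction.  Neither the semigroup nor the index set is assumed
   to be nonempty. *)

HB.mixin Record Semigroup_isInverseSemigroup T of Semigroup T := {
  unique_inverse : forall t : T, exists! s : T, t * s * t = t /\ s * t * s = s
}.

#[short(type="inverseSemigroupType")]
HB.structure Definition InverseSemigroup :=
  {T of Semigroup_isInverseSemigroup T & Semigroup T}.

Section InverseSemigroupTheory.

Variable T : inverseSemigroupType.
Implicit Types s t u v e f : T.

Lemma ginv_exists t : exists s : T, (t * s * t == t) && (s * t * s == s).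
Proof. by have [s [[h1 h2] _]] := unique_inverse t; exists s; rewrite h1 h2 !eqxx. Qed.

Definition ginv t : T := xchoose (ginv_exists t).

Local Notation "t ^*" := (ginv t) : group_scope.

Definition idem e : Prop := e * e = e.

(* The natural partial order. *)
Definition nle s t : Prop := exists2 e, idem e & s = t * e.

Lemma mulgVg t : t * t^* * t = t.
Proof. by have /andP[/eqP] := xchooseP (ginv_exists t). Qed.

Lemma mulVgV t : t^* * t * t^* = t^*.
Proof. by have /andP[_ /eqP] := xchooseP (ginv_exists t). Qed.

Lemma ginv_uniq t s : t * s * t = t -> s * t * s = s -> s = t^*.
Proof.
have [r [_ uniq_r]] := unique_inverse t; move=> h1 h2.
by rewrite -(uniq_r s (conj h1 h2)) -(uniq_r _ (conj (mulgVg t) (mulVgV t))).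
Qed.

Lemma ginvK t : t^*^* = t.
Proof. by symmetry; apply: ginv_uniq; [exact: mulVgV | exact: mulgVg]. Qed.

Lemma ginv_idem e : idem e -> e^* = e.
Proof. by rewrite /idem => ee; symmetry; apply: ginv_uniq; rewrite !ee. Qed.

Lemma idemM e f : idem e -> idem f -> idem (e * f).
Proof.
move=> he hf; have eK u : u * e * e = u * e by rewrite -mulgA he.
have fK u : u * f * f = u * f by rewrite -mulgA hf.
set x := (e * f)^*.
have h1 : e * f * x * (e * f) = e * f := mulgVg _.
have h2 : x * (e * f) * x = x := mulVgV _.
have xE : f * x * e = x.
  apply: ginv_uniq.
    by rewrite !mulgA fK eK -[RHS]h1 !mulgA.
  by rewrite !mulgA eK fK -[in RHS]h2 !mulgA.
have xx : x * x = x.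
  by rewrite -[X in X * _]xE -[X in _ * X]xE -[RHS]xE -[in RHS]h2 !mulgA.
have -> : e * f = x by rewrite -(ginv_idem xx) /x ginvK.
exact: xx.
Qed.

Lemma idemC e f : idem e -> idem f -> e * f = f * e.
Proof.
move=> he hf; have hef := idemM he hf; have hfe := idemM hf he.
have eK u : u * e * e = u * e by rewrite -mulgA he.
have fK u : u * f * f = u * f by rewrite -mulgA hf.
rewrite -[LHS](ginv_idem hef); symmetry; apply: ginv_uniq.
  by rewrite !mulgA fK eK -[RHS]hef !mulgA.
by rewrite !mulgA eK fK -[RHS]hfe !mulgA.
Qed.

Lemma idem_gV t : idem (t * t^*).
Proof. by rewrite /idem mulgA mulgVg. Qed.

Lemma idem_Vg t : idem (t^* * t).
Proof. by rewrite /idem mulgA mulVgV. Qed.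

Lemma ginvM s t : (s * t)^* = t^* * s^*.
Proof.
have C : t * t^* * (s^* * s) = s^* * s * (t * t^*).
  by apply: idemC; [exact: idem_gV | exact: idem_Vg].
symmetry; apply: ginv_uniq.
  have -> : s * t * (t^* * s^*) * (s * t) = s * (t * t^* * (s^* * s)) * t.
    by rewrite !mulgA.
  by rewrite C !mulgA mulgVg -!mulgA (mulgA t) mulgVg.
have -> : t^* * s^* * (s * t) * (t^* * s^*)
          = t^* * (s^* * s * (t * t^*)) * s^* by rewrite !mulgA.
by rewrite -C !mulgA mulVgV -!mulgA (mulgA s^*) mulVgV.
Qed.

Lemma nle_refl t : nle t t.
Proof. by exists (t^* * t); [exact: idem_Vg | rewrite mulgA mulgVg]. Qed.

Lemma nle_anti s t : nle s t -> nle t s -> s = t.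
Proof.
move=> [e he sE] [f hf tE].
have se : s * e = s by rewrite sE -mulgA he.
have te : t * e = t by rewrite tE -mulgA (idemC hf he) mulgA se.
by rewrite sE te.
Qed.

Lemma nle_trans s t u : nle s t -> nle t u -> nle s u.
Proof.
move=> [e he ->] [f hf ->]; exists (f * e); first exact: idemM.
by rewrite mulgA.
Qed.

Lemma nle_idem_mull e t : idem e -> nle (e * t) t.
Proof.
move=> he; have C := idemC he (idem_gV t); exists (t^* * e * t); last first.
  by rewrite -[in LHS](mulgVg t) mulgA C !mulgA.
have -> : t^* * e * t = (e * t)^* * (e * t).
  by rewrite ginvM (ginv_idem he) !mulgA -(mulgA _ e e) he.
exact: idem_Vg.
Qed.

Lemma nle_mull u s t : nle s t -> nle (u * s) (u * t).
Proof. by move=> [e he ->]; exists e; rewrite ?mulgA. Qed.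

Lemma nle_mulr u s t : nle s t -> nle (s * u) (t * u).
Proof.
move=> [e he ->]; rewrite -mulgA.
exact: nle_mull (nle_idem_mull _ he).
Qed.

Lemma nle_mul s t u v : nle s t -> nle u v -> nle (s * u) (t * v).
Proof. by move=> h k; apply: nle_trans (nle_mulr u h) (nle_mull t k). Qed.

End InverseSemigroupTheory.

Notation "t ^*" := (ginv t) : group_scope.

Definition isomorphic (S S' : inverseSemigroupType) : Prop :=
  exists f : {multiplicative S -> S'}, bijective f.

(* The axioms are stated for the curried map [p i j] = p_{i,j}. *)
Record partialMcAlister (T : inverseSemigroupType) (I : choiceType) := {
  mcf :> I -> I -> T;
  MF1 : forall i, idem (mcf i i);
  MF2 : forall i j, mcf i i * mcf i j * mcf j j = mcf i j;
  MF3 : forall i j, (mcf i j)^* = mcf j i;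
  MF4 : forall i j k, nle (mcf i j * mcf j k) (mcf i k)
}.

Section McAlister.

Variables (T : inverseSemigroupType) (I : choiceType).
Variable p : partialMcAlister T I.
Implicit Types (i j k : I) (s t : T).

Lemma mf_idl i j : p i i * p i j = p i j.
Proof. by rewrite -[p i j]MF2 !mulgA MF1. Qed.

Lemma mf_idr i j : p i j * p j j = p i j.
Proof. by rewrite -[p i j]MF2 -!mulgA MF1. Qed.

Lemma mf4l i j k t : nle (p i j * (p j k * t)) (p i k * t).
Proof. by rewrite mulgA; apply/nle_mulr/MF4. Qed.

Lemma mf4r i j k t : nle (t * p i j * p j k) (t * p i k).
Proof. by rewrite -mulgA; apply/nle_mull/MF4. Qed.

(* Triples are written (j, t, i): [rmL] is j, [rmT] is t and [rmR] is i. *)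
Record RM := MkRM {
  rmval : I * T * I;
  rm_mem : p rmval.1.1 rmval.1.1 * rmval.1.2 * p rmval.2 rmval.2 == rmval.1.2
}.

HB.instance Definition _ := [isSub of RM for rmval].
HB.instance Definition _ := [Choice of RM by <:].

Definition rmL (a : RM) : I := (rmval a).1.1.
Definition rmT (a : RM) : T := (rmval a).1.2.
Definition rmR (a : RM) : I := (rmval a).2.

Lemma rm_idl (a : RM) : p (rmL a) (rmL a) * rmT a = rmT a.
Proof. by have /eqP h := rm_mem a; rewrite /rmT -h !mulgA MF1. Qed.

Lemma rm_idr (a : RM) : rmT a * p (rmR a) (rmR a) = rmT a.
Proof. by have /eqP h := rm_mem a; rewrite /rmT -h -!mulgA MF1. Qed.

Lemma rm_mul_mem (a b : RM) :
  let t := rmT a * p (rmR a) (rmL b) * rmT b in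
  p (rmL a) (rmL a) * t * p (rmR b) (rmR b) == t.
Proof. by rewrite /= !mulgA rm_idl -!mulgA rm_idr. Qed.

Definition rm_mul (a b : RM) : RM :=
  @MkRM (rmL a, rmT a * p (rmR a) (rmL b) * rmT b, rmR b) (rm_mul_mem a b).

Lemma rm_mulE a b :
  (rmL (rm_mul a b) = rmL a) * (rmR (rm_mul a b) = rmR b) *
  (rmT (rm_mul a b) = rmT a * p (rmR a) (rmL b) * rmT b).
Proof. by []. Qed.

Lemma rm_ext a b : rmL a = rmL b -> rmT a = rmT b -> rmR a = rmR b -> a = b.
Proof.
case: a b => [[[j t] i] ha] [[[j' t'] i'] hb]; rewrite /rmL /rmT /rmR /=.
by move=> h1 h2 h3; apply: val_inj; rewrite /= h1 h2 h3.
Qed.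

Definition gamma (a b : RM) : bool :=
  (p (rmL a) (rmL b) * rmT b * p (rmR b) (rmR a) == rmT a) &&
  (p (rmL b) (rmL a) * rmT a * p (rmR a) (rmR b) == rmT b).

Lemma gamma_eql a b : gamma a b ->
  rmT a = p (rmL a) (rmL b) * rmT b * p (rmR b) (rmR a).
Proof. by case/andP => /eqP. Qed.

Lemma gammaC a b : gamma a b = gamma b a.
Proof. exact: andbC. Qed.

Lemma gamma_nle a b :
  nle (rmT a) (p (rmL a) (rmL b) * rmT b * p (rmR b) (rmR a)) ->
  nle (rmT b) (p (rmL b) (rmL a) * rmT a * p (rmR a) (rmR b)) -> gamma a b.
Proof.
have half x y : nle (rmT x) (p (rmL x) (rmL y) * rmT y * p (rmR y) (rmR x)) ->
  nle (rmT y) (p (rmL y) (rmL x) * rmT x * p (rmR x) (rmR y)) ->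
  p (rmL x) (rmL y) * rmT y * p (rmR y) (rmR x) = rmT x.
  move=> h1 h2; apply: nle_anti h1.
  apply: nle_trans (nle_mulr _ (nle_mull _ h2)) _.
  rewrite -[X in nle _ X]rm_idr -[X in nle _ (X * _)]rm_idl !mulgA.
  apply: nle_trans (mf4r _ _ _ _) _.
  by do 2!apply: nle_mulr; exact: MF4.
by move=> h1 h2; rewrite /gamma (half a b) // (half b a) // !eqxx.
Qed.

Lemma gamma_refl : reflexive gamma.
Proof. by move=> a; rewrite /gamma rm_idl rm_idr eqxx. Qed.

Lemma gamma_trans : transitive gamma.
Proof.
have half a b c : gamma a b -> gamma b c ->
    nle (rmT a) (p (rmL a) (rmL c) * rmT c * p (rmR c) (rmR a)).
  move=> /gamma_eql {1}-> /gamma_eql ->; rewrite !mulgA.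
  apply: nle_trans (mf4r _ _ _ _) _.
  by do 2!apply: nle_mulr; exact: MF4.
move=> b a c hab hbc; apply: gamma_nle; first exact: half hab hbc.
by apply: half; rewrite gammaC; eassumption.
Qed.

Canonical gamma_equiv := EquivRel gamma gamma_refl gammaC gamma_trans.

Definition IM := {eq_quot gamma_equiv}.
HB.instance Definition _ := Choice.on IM.
HB.instance Definition _ : EqQuotient _ gamma_equiv IM := EqQuotient.on IM.

Lemma IM_ind (P : IM -> Prop) : (forall a : RM, P (\pi_IM a)) -> forall x, P x.
Proof. by move=> h x; rewrite -(reprK x). Qed.

Lemma rm_mul_gamma a a' b b' :
  gamma a a' -> gamma b b' -> gamma (rm_mul a b) (rm_mul a' b').
Proof.
have half x x' y y' : gamma x x' -> gamma y y' ->
    let c := rm_mul x y in let c' := rm_mul x' y' in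
    nle (rmT c) (p (rmL c) (rmL c') * rmT c' * p (rmR c') (rmR c)).
  move=> /gamma_eql hx /gamma_eql hy /=.
  rewrite !rm_mulE {1}hx {1}hy !mulgA.
  do 2!apply: nle_mulr; apply: nle_trans (mf4r _ _ _ _) _.
  exact: mf4r.
move=> ha hb; apply: gamma_nle; first exact: half ha hb.
by apply: half; rewrite gammaC.
Qed.

(* [repr] picks a representative; [im_mulE] shows the choice is immaterial. *)
Definition im_mul (x y : IM) : IM := \pi_IM (rm_mul (repr x) (repr y)).

Lemma im_mulE a b : im_mul (\pi_IM a) (\pi_IM b) = \pi_IM (rm_mul a b).
Proof.
apply/eqP; rewrite eqmodE /=.
by apply: rm_mul_gamma; rewrite -[gamma _ _]/(gamma_equiv _ _) -eqmodE reprK.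
Qed.

Lemma rm_mulA : associative rm_mul.
Proof. by move=> a b c; apply: val_inj; rewrite /= !mulgA. Qed.

Lemma im_mulA : associative im_mul.
Proof.
elim/IM_ind=> a; elim/IM_ind=> b; elim/IM_ind=> c.
by rewrite !im_mulE rm_mulA.
Qed.

HB.instance Definition _ := isSemigroup.Build IM im_mulA.

Lemma rm_star_mem (a : RM) :
  p (rmR a) (rmR a) * (rmT a)^* * p (rmL a) (rmL a) == (rmT a)^*.
Proof. by rewrite -(MF3 p (rmL a)) -(MF3 p (rmR a)) -!ginvM mulgA rm_idl rm_idr. Qed.

Definition rm_star (a : RM) : RM :=
  @MkRM (rmR a, (rmT a)^*, rmL a) (rm_star_mem a).

Lemma rm_starE a :
  (rmL (rm_star a) = rmR a) * (rmR (rm_star a) = rmL a) *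
  (rmT (rm_star a) = (rmT a)^*).
Proof. by []. Qed.

Lemma im_unique_inverse (x : IM) :
  exists! y : IM, x * y * x = x /\ y * x * y = y.
Proof.
elim/IM_ind: x => a; exists (\pi_IM (rm_star a)); split.
  have aE : rm_mul (rm_mul a (rm_star a)) a = a.
    apply: rm_ext; rewrite !(rm_mulE, rm_starE) //.
    by rewrite rm_idr -!mulgA rm_idl !mulgA mulgVg.
  have sE : rm_mul (rm_mul (rm_star a) a) (rm_star a) = rm_star a.
    apply: rm_ext; rewrite !(rm_mulE, rm_starE) //.
    by rewrite -(mulgA _ _ (rmT a)) rm_idl -(mulgA _ (rmT a)) rm_idr mulVgV.
  by rewrite /mul /= !im_mulE aE sE.
elim/IM_ind=> b; rewrite /mul /= !im_mulE => -[].
move=> /eqP; rewrite eqmodE /= => /gamma_eql.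
rewrite !(rm_mulE, rm_starE) rm_idl rm_idr => h1.
move=> /eqP; rewrite eqmodE /= => /gamma_eql.
rewrite !(rm_mulE, rm_starE) rm_idl rm_idr => h2.
have e1 : p (rmR a) (rmL b) * rmT b * p (rmR b) (rmL a) = (rmT a)^*.
  apply: ginv_uniq; first by rewrite -[RHS]h1 !mulgA.
  by rewrite -{3}h2 !mulgA.
have e2 : rmT b = p (rmL b) (rmR a) * (rmT a)^* * p (rmL a) (rmR b).
  rewrite -(MF3 p (rmR a)) -(MF3 p (rmR b)) -!ginvM.
  apply: ginv_uniq; last by rewrite -[RHS]h2 !mulgA.
  by rewrite -{3}h1 !mulgA.
apply/eqP; rewrite eqmodE /= /gamma.
by rewrite !rm_starE e1 -e2 !eqxx.
Qed.

HB.instance Definition _ :=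
  Semigroup_isInverseSemigroup.Build IM im_unique_inverse.

Record Upre := MkUpre {
  upval : I * T;
  up_mem : p upval.1 upval.1 * upval.2 == upval.2
}.

HB.instance Definition _ := [isSub of Upre for upval].
HB.instance Definition _ := [Choice of Upre by <:].

Definition upI (a : Upre) : I := (upval a).1.
Definition upT (a : Upre) : T := (upval a).2.

Lemma up_id (a : Upre) : p (upI a) (upI a) * upT a = upT a.
Proof. exact/eqP/(up_mem a). Qed.

Definition usim (a b : Upre) : bool :=
  (upT a == p (upI a) (upI b) * upT b) && (upT b == p (upI b) (upI a) * upT a).

Lemma usim_eql a b : usim a b -> upT a = p (upI a) (upI b) * upT b.
Proof. by case/andP => /eqP. Qed.

Lemma usimC a b : usim a b = usim b a.
Proof. exact: andbC. Qed.

Lemma usim_nle a b :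
  nle (upT a) (p (upI a) (upI b) * upT b) ->
  nle (upT b) (p (upI b) (upI a) * upT a) -> usim a b.
Proof.
have half x y : nle (upT x) (p (upI x) (upI y) * upT y) ->
  nle (upT y) (p (upI y) (upI x) * upT x) ->
  upT x = p (upI x) (upI y) * upT y.
  move=> h1 h2; apply: nle_anti h1 _.
  apply: nle_trans (nle_mull _ h2) _.
  by rewrite -[X in nle _ X]up_id; apply: mf4l.
by move=> h1 h2; rewrite /usim -(half a b) // -(half b a) // !eqxx.
Qed.

Lemma usim_refl : reflexive usim.
Proof. by move=> a; rewrite /usim up_id eqxx. Qed.

Lemma usim_trans : transitive usim.
Proof.
have half a b c : usim a b -> usim b c -> nle (upT a) (p (upI a) (upI c) * upT c).
  by move=> /usim_eql -> /usim_eql ->; apply: mf4l.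
move=> b a c hab hbc; apply: usim_nle; first exact: half hab hbc.
by apply: half; rewrite usimC; eassumption.
Qed.

Canonical usim_equiv := EquivRel usim usim_refl usimC usim_trans.

Definition U := {eq_quot usim_equiv}.
HB.instance Definition _ := Choice.on U.
HB.instance Definition _ : EqQuotient _ usim_equiv U := EqQuotient.on U.

Lemma U_ind (P : U -> Prop) : (forall a : Upre, P (\pi_U a)) -> forall x, P x.
Proof. by move=> h x; rewrite -(reprK x). Qed.

Lemma up_act_mem (a : Upre) t :
  p (upI a) (upI a) * (upT a * t) == upT a * t.
Proof. by rewrite mulgA up_id. Qed.

Definition up_act (a : Upre) t : Upre :=
  @MkUpre (upI a, upT a * t) (up_act_mem a t).

Lemma up_actE a t : (upI (up_act a t) = upI a) * (upT (up_act a t) = upT a * t).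
Proof. by []. Qed.

Lemma up_ext a b : upI a = upI b -> upT a = upT b -> a = b.
Proof.
case: a b => [[j t] ha] [[j' t'] hb]; rewrite /upI /upT /=.
by move=> h1 h2; apply: val_inj; rewrite /= h1 h2.
Qed.

Definition up_pair (b a : Upre) : T := (upT b)^* * p (upI b) (upI a) * upT a.

(* Independence of the representatives is [uactE] and [upairE] below. *)
Definition uact (x : U) t : U := \pi_U (up_act (repr x) t).
Definition upair (y x : U) : T := up_pair (repr y) (repr x).

Lemma usim_repr a : usim (repr (\pi_U a)) a.
Proof. by rewrite -[usim _ _]/(usim_equiv _ _) -eqmodE reprK. Qed.

Lemma uactE a t : uact (\pi_U a) t = \pi_U (up_act a t).
Proof.
apply/eqP; rewrite eqmodE /=.
have h := usim_repr a; have h1 := usim_eql h.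
move: h; rewrite usimC => /usim_eql h2.
by rewrite /usim !up_actE !mulgA -h1 -h2 !eqxx.
Qed.

Lemma upairE b a : upair (\pi_U b) (\pi_U a) = up_pair b a.
Proof.
have half x x' y y' : usim x x' -> usim y y' -> nle (up_pair x y) (up_pair x' y').
  move=> /usim_eql hx /usim_eql hy; rewrite /up_pair hx hy ginvM MF3.
  rewrite !mulgA; apply: nle_mulr.
  apply: nle_trans (mf4r _ _ _ _) _; exact: mf4r.
have ha := usim_repr a; have hb := usim_repr b.
by apply: nle_anti; apply: half; rewrite // usimC.
Qed.

Definition omega (v u : U) (x : U) : U := uact v (upair u x).

Record K := MkK {
  kval :> U -> U;
  k_mem : `[< exists v u : U, kval = omega v u >]
}.

HB.instance Definition _ := [isSub of K for kval].
HB.instance Definition _ := [Choice of K by <:].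

Lemma kP (w : K) : exists v u, kval w = omega v u.
Proof. exact/asboolP/k_mem. Qed.

Lemma omega_mem v u : `[< exists v' u' : U, omega v u = omega v' u' >].
Proof. by apply/asboolP; exists v, u. Qed.

Lemma omega_comp v u v' u' :
  omega v u \o omega v' u' = omega (uact v (upair u v')) u'.
Proof.
apply: funext => x; rewrite /omega /=.
elim/U_ind: v => v; elim/U_ind: u => u; elim/U_ind: v' => v'.
elim/U_ind: u' => u'; elim/U_ind: x => x.
rewrite !(upairE, uactE); congr (\pi_U _).
by apply: up_ext; rewrite /up_pair !up_actE // !mulgA.
Qed.

Lemma k_mul_mem (w w' : K) :
  `[< exists v u : U, kval w \o kval w' = omega v u >].
Proof.
have [v [u ->]] := kP w; have [v' [u' ->]] := kP w'.
by rewrite omega_comp; exact: omega_mem.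
Qed.

Definition k_mul (w w' : K) : K := MkK (k_mul_mem w w').

Lemma k_mulA : associative k_mul.
Proof. by move=> a b c; apply: val_inj. Qed.

HB.instance Definition _ := isSemigroup.Build K k_mulA.

Lemma omega_act (v u x : Upre) :
  omega (\pi_U v) (\pi_U u) (\pi_U x) = \pi_U (up_act v (up_pair u x)).
Proof. by rewrite /omega upairE uactE. Qed.

Lemma omegaVK v u : omega v u \o omega u v \o omega v u = omega v u.
Proof.
apply: funext => x /=.
elim/U_ind: v => v; elim/U_ind: u => u; elim/U_ind: x => x.
rewrite !omega_act; congr (\pi_U _); apply: up_ext; rewrite /up_pair !up_actE //.
have C := idemC (idem_Vg (upT u)) (idem_Vg (upT v)).
transitivity (upT v * ((upT u)^* * (p (upI u) (upI u) * upT u)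
    * ((upT v)^* * (p (upI v) (upI v) * upT v)))
    * ((upT u)^* * p (upI u) (upI x) * upT x)); first by rewrite !mulgA.
rewrite !up_id C !mulgA mulgVg -(mulgA _ (upT u)^* (upT u)).
by rewrite -(mulgA _ (_ * _) (upT u)^*) mulVgV.
Qed.

Definition kmk v u : K := MkK (omega_mem v u).

Lemma omega_inv_uniq (v u : Upre) (w : K) :
  omega (\pi_U v) (\pi_U u) \o w \o omega (\pi_U v) (\pi_U u)
    = omega (\pi_U v) (\pi_U u) ->
  w \o omega (\pi_U v) (\pi_U u) \o w = w ->
  kval w = omega (\pi_U u) (\pi_U v).
Proof.
have [v' [u' ->]] := kP w; elim/U_ind: v' => v'; elim/U_ind: u' => u'.
have key (x y x' y' : Upre) :
    omega (\pi_U x) (\pi_U y) \o omega (\pi_U x') (\pi_U y')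
      \o omega (\pi_U x) (\pi_U y) = omega (\pi_U x) (\pi_U y) ->
    let a := upT x * (upT y)^* in let b := upT x' * (upT y')^* in
    a * (p (upI y) (upI x') * b * p (upI y') (upI x)) * a = a.
  move=> h /=; pose z := @MkUpre (upI y, p (upI y) (upI y)) (introT eqP (MF1 p _)).
  have := congr1 (fun f => f (\pi_U z)) h; rewrite /= !omega_act.
  move=> /eqP; rewrite eqmodE /= => /usim_eql.
  have yE : (upT y)^* * p (upI y) (upI y) = (upT y)^*.
    by rewrite -[in LHS](MF3 p) -ginvM up_id.
  rewrite /up_pair !up_actE -[upI z]/(upI y) -[upT z]/(p _ _) (mulgA (p _ _)) up_id.
  by rewrite -(mulgA _ _ (p _ _)) MF1 yE !mulgA.
move=> /key /= h1 /key /= h2.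
set a := upT v * _ in h1 h2; set b := upT v' * _ in h1 h2.
have e1 : p (upI u) (upI v') * b * p (upI u') (upI v) = a^*.
  apply: ginv_uniq; first exact: h1.
  by rewrite -[in RHS]h2 !mulgA.
have e2 : b = p (upI v') (upI u) * a^* * p (upI v) (upI u').
  rewrite -(MF3 p (upI u)) -(MF3 p (upI u')) -!ginvM.
  apply: ginv_uniq; last by rewrite -[RHS]h2 !mulgA.
  by rewrite -[in RHS]h1 !mulgA.
have aE : a^* = upT u * (upT v)^* by rewrite ginvM ginvK.
apply: funext => x; elim/U_ind: x => x; rewrite !omega_act.
apply/eqP; rewrite eqmodE /=; apply: usim_nle; rewrite /up_pair !up_actE !mulgA.
  rewrite -/b e2 -(mulgA _ (upT u)) -aE.
  by apply: nle_mulr; apply: mf4r.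
rewrite -aE -e1 -(mulgA _ (upT v')) -/b.
by apply: nle_mulr; apply: mf4r.
Qed.

Lemma k_unique_inverse (x : K) :
  exists! y : K, x * y * x = x /\ y * x * y = y.
Proof.
have kE (a b : K) : kval (a * b) = kval a \o kval b by [].
have [v [u xE]] := kP x; exists (kmk u v); split.
  by split; apply: val_inj; rewrite /= xE; exact: omegaVK.
move=> w [/(congr1 kval) h1 /(congr1 kval) h2]; apply: val_inj => /=.
move: h1 h2; rewrite !kE xE.
elim/U_ind: v {xE} => v; elim/U_ind: u => u h1 h2.
by rewrite (omega_inv_uniq h1 h2).
Qed.

HB.instance Definition _ :=
  Semigroup_isInverseSemigroup.Build K k_unique_inverse.

End McAlister.

(* Main.v *)
Require Import Defs.
From mathcomp Require Import ssreflect ssrfun ssrbool eqtype choice monoid.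
From HB Require Import structures.
From mathcomp Require Import generic_quotient boolp.

(** Read [U p] as a module over [T] with the [T]-valued pairing [upair].  It
    is generated by the vectors [[i, p i i]], so a class [[j, t, i]] of the
    Rees matrix semigroup should be thought of as the rank-one operator with
    the single matrix entry [t] in position [(j, i)], namely
      [omega [j, t] [i, p i i] : [k, s] |-> [j, t * p i k * s]].
    The isomorphism sends [[j, t, i]] to this operator.

    The formula for the operator makes everything visible.  Composing the
    operators of [(j, t, i)] and [(j', t', i')] yields the entry
    [t * p i j' * t'], which is the Rees matrix product ([rm_op_mul]).  Every
    [omega [j, s] [i, t]] is the operator of [(j, s * t^*, i)], so the map is
    onto ([rm_op_surj]).  Finally, the operator determines the triple exactly
    up to [gamma] ([rm_op_gamma]): evaluating at the generator [[i, p i i]]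
    gives back the entry [t], while (MF4) bounds the action of one of two
    [gamma]-related triples by the action of the other. *)

Set Implicit Arguments.
Unset Strict Implicit.
Unset Printing Implicit Defensive.

Local Open Scope group_scope.
Local Open Scope quotient_scope.

Lemma inj_surj_bij (S : choiceType) (S' : eqType) (f : S -> S') :
  injective f -> (forall y, exists x, f x = y) -> bijective f.
Proof.
move=> f_inj f_surj.
have f_surjb y : exists x, f x == y by have [x <-] := f_surj y; exists x.
have fK y : f (xchoose (f_surjb y)) = y by apply/eqP/(xchooseP (f_surjb y)).
exists (fun y => xchoose (f_surjb y)) => // x.
exact: f_inj.
Qed.

Section Operators.

Variables (T : inverseSemigroupType) (I : choiceType).
Variable p : partialMcAlister T I.
Implicit Types a b : RM p.

Definition up_col a : Upre p :=
  @MkUpre T I p (rmL a, rmT a) (introT eqP (rm_idl a)).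

Definition up_gen i : Upre p := @MkUpre T I p (i, p i i) (introT eqP (MF1 p i)).

Definition rm_op a : K p := kmk (\pi_(U p) (up_col a)) (\pi_(U p) (up_gen (rmR a))).

Lemma rm_op_mem a (x : Upre p) :
  p (rmL a) (rmL a) * (rmT a * p (rmR a) (upI x) * upT x)
    == rmT a * p (rmR a) (upI x) * upT x.
Proof. by rewrite !mulgA rm_idl. Qed.

Definition up_op a (x : Upre p) : Upre p :=
  @MkUpre T I p (rmL a, rmT a * p (rmR a) (upI x) * upT x) (rm_op_mem a x).

Lemma up_opE a x : (upI (up_op a x) = rmL a) *
  (upT (up_op a x) = rmT a * p (rmR a) (upI x) * upT x).
Proof. by []. Qed.

Lemma rm_opE a x : kval (rm_op a) (\pi_(U p) x) = \pi_(U p) (up_op a x).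
Proof.
rewrite /= omega_act; congr (\pi_(U p) _); apply: up_ext => //.
rewrite up_actE up_opE /up_pair -[upT (up_gen _)]/(p _ _) MF3.
by rewrite -[upI (up_gen _)]/(rmR a) mf_idl mulgA.
Qed.

Lemma K_ext (w w' : K p) :
  (forall x : Upre p, kval w (\pi_(U p) x) = kval w' (\pi_(U p) x)) -> w = w'.
Proof.
by move=> ww'; apply: val_inj; apply: funext; elim/U_ind=> x; exact: ww'.
Qed.

Lemma rm_op_mul a b : rm_op (rm_mul a b) = rm_op a * rm_op b.
Proof.
apply: K_ext => x; rewrite -[kval (_ * _) _]/(kval _ (kval _ _)) !rm_opE.
congr (\pi_(U p) _); apply: up_ext => //.
by rewrite !up_opE !rm_mulE !mulgA.
Qed.

(** (MF4) gives [p i i' * p i' k <= p i k], hence only an inequality between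
    the two actions; antisymmetry, packaged in [usim_nle], does the rest. *)
Lemma gamma_up_op a b x : gamma a b -> usim (up_op a x) (up_op b x).
Proof.
have half c d : gamma c d -> nle (upT (up_op c x))
    (p (upI (up_op c x)) (upI (up_op d x)) * upT (up_op d x)).
  move=> /gamma_eql cd; rewrite !up_opE {1}cd !mulgA.
  by apply: nle_mulr; exact: mf4r.
by move=> ab; apply: usim_nle; apply: half; rewrite // gammaC.
Qed.

(** One generator suffices to recover each half of [gamma] from an equality of
    operators: that of [(j, t, i)] maps [[i, p i i]] to [[j, t]], that of
    [(j', t', i')] maps it to [[j', t' * p i' i]], and comparing these classes
    gives [t = p j j' * t' * p i' i]. *)
Lemma rm_op_gamma a b : rm_op a = rm_op b <-> gamma a b.
Proof.
split=> [ab | ab]; last first.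
  apply: K_ext => x; rewrite !rm_opE.
  by apply/eqP; rewrite eqmodE; exact: gamma_up_op.
have half c d : rm_op c = rm_op d ->
    p (rmL c) (rmL d) * rmT d * p (rmR d) (rmR c) == rmT c.
  move=> cd; have /eqP := rm_opE c (up_gen (rmR c)).
  rewrite cd rm_opE eqmodE /= usimC => /usim_eql.
  rewrite !up_opE -[upI (up_gen _)]/(rmR c) -[upT (up_gen _)]/(p _ _).
  by rewrite !rm_idr -!mulgA mf_idr => <-.
by rewrite /gamma !half.
Qed.

Lemma rm_op_surj (w : K p) : exists a, rm_op a = w.
Proof.
have [v [u wE]] := kP w.
elim/U_ind: v wE => v; elim/U_ind: u => u wE.
have uK : (upT u)^* * p (upI u) (upI u) = (upT u)^*.
  by rewrite -[in LHS](MF3 p) -ginvM up_id.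
have a_mem : p (upI v) (upI v) * (upT v * (upT u)^*) * p (upI u) (upI u)
    == upT v * (upT u)^*.
  by rewrite mulgA up_id -mulgA uK.
exists (@MkRM T I p (upI v, upT v * (upT u)^*, upI u) a_mem).
apply: K_ext => x; rewrite rm_opE wE omega_act.
congr (\pi_(U p) _); apply: up_ext => //.
by rewrite up_actE up_opE /up_pair !mulgA.
Qed.

Definition im_op (x : IM p) : K p := rm_op (repr x).

Lemma im_opE a : im_op (\pi_(IM p) a) = rm_op a.
Proof.
by apply/rm_op_gamma; rewrite -[gamma _ _]/(gamma_equiv p _ _) -eqmodE reprK.
Qed.

Lemma im_op_mul : {morph im_op : x y / x * y}.
Proof.
elim/IM_ind=> a; elim/IM_ind=> b.
by rewrite [in LHS]/mul /= im_mulE !im_opE rm_op_mul.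
Qed.

Lemma im_op_bij : bijective im_op.
Proof.
apply: inj_surj_bij => [|w]; last first.
  by have [a <-] := rm_op_surj w; exists (\pi_(IM p) a); exact: im_opE.
elim/IM_ind=> a; elim/IM_ind=> b; rewrite !im_opE => /rm_op_gamma ab.
by apply/eqP; rewrite eqmodE.
Qed.

HB.instance Definition _ := isMultiplicative.Build (IM p) (K p) im_op im_op_mul.

End Operators.

Theorem corollary7p5 (T : inverseSemigroupType) (I : choiceType)
    (p : partialMcAlister T I) :
  isomorphic (IM p) (K p).
Proof.
by exists (im_op (p := p)); exact: im_op_bij.
Qed.
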